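(* Suppose that $f$ is $m$-smooth and consider SVRCD-inv (defined in the context) with stepsize $\alpha=\min_i\frac1{4\frac m\delta+\frac\sigma{p_i}}$. Then its iteration complexity is $\max_i\left(4\frac m{\sigma\delta}+\frac1{p_i}\right)\log\frac1\epsilon$; that is, there exists $b\in\mathbb R^d$ with positive entries such that, with $$\Psi^k=\|x^k-x^*\|^2+\frac\alpha m\sum_{i=1}^db_i^2\left(h_i^k-\nabla_if(x^* )\right)^2,$$ for every $\epsilon\in(0,1)$ and every integer $k\ge\max_i\left(4\frac m{\sigma\delta}+\frac1{p_i}\right)\log\frac1\epsilon$ we have $\mathbb E[\Psi^k]\le\epsilon\,\Psi^0$.
   Context: Problem (single function, $n=1$). $f:\mathbb R^d\to\mathbb R$ is differentiable and convex, $\psi:\mathbb R^d\to\mathbb R\cup\{+\infty\}$ is proper, closed and convex. $\min_x f(x)+\psi(x)$ has a unique minimizer $x^*$, and $f$ is $\sigma$-quasi strongly convex with $\sigma>0$: $f(x^* )\ge f(y)+\langle\nabla f(y),x^*-y\rangle+\frac\sigma2\|y-x^*\|^2$ for all $y$. $m$-smoothness ($m>0$) means $f(x)\le f(y)+\langle\nabla f(y),x-y\rangle+\frac m2\|x-y\|^2$ for all $x,y$. $\mathrm{prox}_{\alpha\psi}(x)=\arg\min_u\{\alpha\psi(u)+\frac12\|u-x\|^2\}$; $e_i$ is the $i$-th standard basis vector of $\mathbb R^d$. Sampling. $L$ is a random subset of $[d]$ with arbitrary distribution such that $p_i=\mathbb P(i\in L)>0$ for all $i$; $\delta\in(0,1]$.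 Algorithm (SVRCD-inv). Given $x^0,h^0\in\mathbb R^d$. For $k=0,1,2,\dots$ (with randomness independent of the past): $g^k=h^k$ with probability $1-\delta$, and $g^k=\frac1\delta\nabla f(x^k)-\left(\frac1\delta-1\right)h^k$ with probability $\delta$; $x^{k+1}=\mathrm{prox}_{\alpha\psi}(x^k-\alpha g^k)$; draw an independent copy $L^k$ of $L$ and set $h^{k+1}=h^k+\sum_{i\in L^k}(\nabla_if(x^k)-h_i^k)e_i$. *)

(* Defs.v *)
From HB Require Import structures.
From mathcomp Require Import all_boot all_order all_algebra.
From mathcomp Require Import all_classical all_reals all_analysis.

Set Implicit Arguments.
Unset Strict Implicit.
Unset Printing Implicit Defensive.

Import Order.TTheory GRing.Theory Num.Theory.
Import numFieldNormedType.Exports.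

Local Open Scope classical_set_scope.
Local Open Scope ring_scope.

Section Euclidean.
Context {R : realType} {d : nat}.
Implicit Types (f : 'rV[R]_d.+1 -> R) (x y : 'rV[R]_d.+1).

Definition dotp x y : R := \sum_i x 0 i * y 0 i.

(* The library norm `|x| on 'rV[R]_d.+1 is the sup norm; this is the square of
   the Euclidean one. The two norms induce the same topology, so [differentiable]
   and [closed] have their usual meaning. *)
Definition sqnorm x : R := dotp x x.

Definition grad f x : 'rV[R]_d.+1 := \row_i 'D_(delta_mx 0 i) f x.

Definition smooth (m : R) f :=
  forall x y, f x <= f y + dotp (grad f y) (x - y) + m / 2 * sqnorm (x - y).

Definition quasi_strongly_convex (sigma : R) f (xstar : 'rV[R]_d.+1) :=
  forall y, f y + dotp (grad f y) (xstar - y) + sigma / 2 * sqnorm (y - xstar)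
            <= f xstar.

End Euclidean.

Section ExtendedValued.
Context {R : realType} {d : nat}.
Implicit Types (F psi : 'rV[R]_d.+1 -> \bar R).

Definition argmin F : set 'rV[R]_d.+1 := [set x | forall y, (F x <= F y)%E].

Definition proper_fun psi :=
  (forall x, psi x <> -oo%E) /\ (exists x, psi x <> +oo%E).

Definition closed_fun psi :=
  closed [set z : 'rV[R]_d.+1 * R | (psi z.1 <= z.2%:E)%E].

(* At t = 0 or t = 1 the convention 0 * +oo = 0 makes the inequality trivial. *)
Definition convex_fun psi :=
  forall (t : R) x y, 0 <= t <= 1 ->
    (psi (t *: x + (1 - t) *: y)%R <= t%:E * psi x + (1 - t)%:E * psi y)%E.

(* The default value 0 is irrelevant: for alpha > 0 and psi proper, closed and
   convex the argmin is a singleton. *)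
Definition prox (alpha : R) psi (x : 'rV[R]_d.+1) : 'rV[R]_d.+1 :=
  xget 0 (argmin
    (fun u => (alpha%:E * psi u + (2^-1 * sqnorm (u - x)%R)%:E)%E)).

End ExtendedValued.

Definition fin_min {R : realType} {d : nat} (F : 'I_d.+1 -> R) : R :=
  \big[Num.min/F ord0]_i F i.

Definition fin_max {R : realType} {d : nat} (F : 'I_d.+1 -> R) : R :=
  \big[Num.max/F ord0]_i F i.

Section Randomness.
Context {R : realType} {disp : measure_display} {T : measurableType disp}.
Variable P : probability T R.

(* Random variables with values in a finite (discrete) type V, every subset of
   which is measurable. *)
Definition events_of {V : finType} (X : T -> V) : set (set T) :=
  [set X @^-1` B | B in [set: set V]].

Definition discrete_rv {V : finType} (X : T -> V) :=
  events_of X `<=` measurable.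

Definition same_law {V : finType} (X Y : T -> V) :=
  forall B : set V, P (X @^-1` B) = P (Y @^-1` B).

Definition mutually_independent {I : eqType} (E : I -> set (set T)) :=
  forall (J : seq I) (A : I -> set T), uniq J ->
    (forall i, i \in J -> E i (A i)) ->
    P (\bigcap_(i in [set` J]) A i) = (\prod_(i <- J) P (A i))%E.

Definition inclusion_prob {d : nat} (L : T -> {set 'I_d}) (i : 'I_d) : R :=
  fine (P [set t | i \in L t]).

(* coin k decides which formula defines g^k, Ls k is the subset drawn at
   iteration k. *)
Definition svrcd_inv_randomness {d : nat} (delta : R) (L : T -> {set 'I_d})
    (coin : nat -> T -> bool) (Ls : nat -> T -> {set 'I_d}) :=
  [/\ forall k, discrete_rv (coin k) /\ P [set t | coin k t] = delta%:E,
      forall k, discrete_rv (Ls k) /\ same_law (Ls k) L &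
      mutually_independent (fun i : nat + nat =>
        match i with
        | inl k => events_of (coin k)
        | inr k => events_of (Ls k)
        end)].

End Randomness.

Section Algorithm.
Context {R : realType} {d : nat}.
Variables (f : 'rV[R]_d.+1 -> R) (psi : 'rV[R]_d.+1 -> \bar R).
Variables (alpha delta : R).

Definition svrcd_inv_step (c : bool) (S : {set 'I_d.+1})
    (xh : 'rV[R]_d.+1 * 'rV[R]_d.+1) : 'rV[R]_d.+1 * 'rV[R]_d.+1 :=
  let: (x, h) := xh in
  let g := if c then (1 / delta) *: grad f x - (1 / delta - 1) *: h else h in
  (prox alpha psi (x - alpha *: g),
   h + \sum_(i in S) (grad f x 0 i - h 0 i) *: delta_mx 0 i).

Fixpoint svrcd_inv (T : Type) (coin : nat -> T -> bool)
    (Ls : nat -> T -> {set 'I_d.+1}) (x0 h0 : 'rV[R]_d.+1) (k : nat) (t : T)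
    : 'rV[R]_d.+1 * 'rV[R]_d.+1 :=
  if k is k'.+1 then
    svrcd_inv_step (coin k' t) (Ls k' t) (svrcd_inv coin Ls x0 h0 k' t)
  else (x0, h0).

End Algorithm.

Definition lyapunov {R : realType} {d : nat} (f : 'rV[R]_d.+1 -> R)
    (alpha m : R) (b xstar : 'rV[R]_d.+1)
    (xh : 'rV[R]_d.+1 * 'rV[R]_d.+1) : R :=
  sqnorm (xh.1 - xstar) +
  alpha / m * \sum_i b 0 i ^+ 2 * (xh.2 0 i - grad f xstar 0 i) ^+ 2.

(* Main.v *)
Require Import Defs.
From HB Require Import structures.
From mathcomp Require Import all_boot all_order all_algebra.
From mathcomp Require Import all_classical all_reals all_analysis.
From mathcomp Require Import measurable_realfun ring lra.

Set Implicit Arguments.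
Unset Strict Implicit.
Unset Printing Implicit Defensive.

Import Order.TTheory GRing.Theory Num.Theory.
Import numFieldNormedType.Exports.

Local Open Scope classical_set_scope.
Local Open Scope ring_scope.

(** Write [gs] for the gradient at [xstar], [a = grad f x - gs] and [w = h - gs].
    As [xstar] is a fixed point of the proximal step and [prox] is nonexpansive,
    the next iterate is at squared distance at most
    [||x - xstar - alpha (g - gs)||^2] from [xstar].  The estimator [g] is
    unbiased and [E ||g - gs||^2 <= 2/delta (||a||^2 + ||w||^2)], while
    cocoercivity and quasi strong convexity give
    [<a, x - xstar> >= ||a||^2 / (2 m) + sigma/2 ||x - xstar||^2].  Coordinate
    [i] of [w] becomes that of [a] with probability [p_i].  With the weights
    [b_i^2 = 1 / (2 p_i)] and [alpha (4 m / delta + sigma / p_i) <= 1] the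
    Lyapunov function then contracts in expectation by the factor
    [1 - alpha sigma] at every step. *)

(** * Euclidean inner product and elementary inequalities *)

Section InnerProduct.
Context {R : realType} {d : nat}.
Implicit Types (u v w : 'rV[R]_d.+1) (a : R).

Lemma dotpC u v : dotp u v = dotp v u.
Proof. by apply: eq_bigr => i _; rewrite mulrC. Qed.

Lemma dotpDl u v w : dotp (u + v) w = dotp u w + dotp v w.
Proof. by rewrite -big_split; apply: eq_bigr => i _; rewrite mxE mulrDl. Qed.

Lemma dotpDr u v w : dotp w (u + v) = dotp w u + dotp w v.
Proof. by rewrite dotpC dotpDl !(dotpC w). Qed.

Lemma dotpZl a u v : dotp (a *: u) v = a * dotp u v.
Proof. by rewrite mulr_sumr; apply: eq_bigr => i _; rewrite mxE mulrA. Qed.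

Lemma dotpZr a u v : dotp u (a *: v) = a * dotp u v.
Proof. by rewrite dotpC dotpZl dotpC. Qed.

Lemma dotpNl u v : dotp (- u) v = - dotp u v.
Proof. by rewrite -scaleN1r dotpZl mulN1r. Qed.

Lemma dotpNr u v : dotp u (- v) = - dotp u v.
Proof. by rewrite dotpC dotpNl dotpC. Qed.

Definition dotpE := (dotpDl, dotpDr, dotpNl, dotpNr, dotpZl, dotpZr).

Lemma sqnormE u : sqnorm u = \sum_i u 0 i ^+ 2.
Proof. by apply: eq_bigr => i _; rewrite expr2. Qed.

Lemma sqnorm_ge0 u : 0 <= sqnorm u.
Proof. by rewrite sqnormE sumr_ge0 // => i _; exact: sqr_ge0. Qed.

Lemma sqr_coord_le_sqnorm u i : u 0 i ^+ 2 <= sqnorm u.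
Proof.
rewrite sqnormE (bigD1 i) //= lerDl sumr_ge0 // => j _; exact: sqr_ge0.
Qed.

Lemma sqnormB u v : sqnorm (u - v) = sqnorm u - 2 * dotp u v + sqnorm v.
Proof. by rewrite /sqnorm !dotpE (dotpC v u); ring. Qed.

Lemma dotp_ge_sqnorm u v : - (2^-1 * (sqnorm u + sqnorm v)) <= dotp u v.
Proof.
by have := sqnorm_ge0 (u + v); rewrite /sqnorm !dotpE (dotpC v u); lra.
Qed.

(** Expanding [0 <= sqnorm (v - u)] is enough; this replaces Cauchy-Schwarz in passing from firm
    nonexpansiveness to nonexpansiveness. *)
Lemma sqnorm_le_of_dotp u v : sqnorm u <= dotp v u -> sqnorm u <= sqnorm v.
Proof. by have := sqnorm_ge0 (v - u); rewrite sqnormB; lra. Qed.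

Lemma sqnorm_continuous w : continuous (fun u => sqnorm (u - w)).
Proof.
rewrite (_ : (fun u => _) =
    (fun u => \sum_i (u 0 i - w 0 i) * (u 0 i - w 0 i))); last first.
  by apply/funext => v; apply: eq_bigr => i _; rewrite !mxE.
apply: (continuous_big (@add_continuous R^o)) => i _ u.
have cB : {for u, continuous (fun v : 'rV[R]_d.+1 => v 0 i - w 0 i)}.
  by apply: continuousB; [exact: coord_continuous|exact: cst_continuous].
exact: (continuousM cB cB).
Qed.

End InnerProduct.

(** Lets [t] tend to 0: it removes the error that remains after a convexity inequality along a
    segment has been divided by [t]. *)
Lemma ler_lin_eps (R : realFieldType) (a b c : R) :
  (forall t, 0 < t <= 1 -> a <= b + t * c) -> a <= b.
Proof.
move=> H; apply/ler_addgt0Pr => e e0.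
have c0 : 0 < `|c| + 1 by rewrite ltr_wpDl.
(* The [+ 1] keeps the divisor positive when [c = 0]. *)
pose t := Num.min 1 (e / (`|c| + 1)).
have t0 : 0 < t by rewrite lt_min ltr01 divr_gt0.
have t1 : t <= 1 by rewrite ge_min lexx.
apply: (le_trans (H t _)); first by rewrite t0 t1.
rewrite lerD2l; have : t * (`|c| + 1) <= e.
  by rewrite -ler_pdivlMr // ge_min lexx orbT.
apply: le_trans; rewrite ler_wpM2l ?(ltW t0) //.
by rewrite (le_trans (ler_norm _)) // lerDl.
Qed.

(** * Gradients of convex functions: tangents and cocoercivity *)

Section Gradient.
Context {R : realType} {d : nat}.
Variable f : 'rV[R]_d.+1 -> R.
Hypothesis f_diff : forall x, differentiable f x.
Hypothesis f_convex : convex_function [set: 'rV[R]_d.+1] f.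

(** [grad] only collects partial derivatives; linearity of the differential extends them to every
    direction. *)
Lemma dotp_grad x v : dotp (grad f x) v = 'D_v f x.
Proof.
rewrite deriveE // {2}[v]row_sum_delta linear_sum; apply: eq_bigr => i _.
by rewrite mxE linearZ deriveE //= mulrC.
Qed.

(** By convexity the difference quotients along [y - x] with step in (0,1) are at most [f y - f x],
    and their right limit inherits the bound. *)
Lemma convex_ge_tangent x y : f x + dotp (grad f x) (y - x) <= f y.
Proof.
rewrite dotp_grad -lerBrDl.
have cv : derivable f x (y - x) by exact: diff_derivable.
have := cvg_dnbhs_at_right cv.
set g := (fun h : R => _) => gcv.
have -> : 'D_(y - x) f x = lim (g h @[h --> 0^'+]).
  exact/esym/(cvg_lim (@Rhausdorff R) gcv).
apply: limr_le; first by apply/cvg_ex; eexists; exact: gcv.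
near=> h.
have h0 : 0 < h by [].
have h1 : h < 1 by near: h; apply: nbhs_right_lt.
have := f_convex (Itv01 (ltW h0) (ltW h1)) (mem_set (I : [set: 'rV[R]_d.+1] y))
           (mem_set (I : [set: 'rV[R]_d.+1] x)).
rewrite /conv /= => H.
rewrite /g /= -[_ *: _]/(_ * _) ler_pdivrMl //.
have -> : h *: (y - x) + x = h *: y + (1 - h) *: x.
  by rewrite scalerBr scalerBl scale1r -addrA [in RHS](addrC x).
have {}H : f (h *: y + (1 - h) *: x) <= h * f y + (1 - h) * f x by exact: H.
lra.
Unshelve. all: by end_near. Qed.

(** With [a] the gradient difference, [f (x - a / m)] is bounded above by smoothness at [x] and
    below by the tangent at [z]. The test point minimizes the difference of these two bounds. *)
Lemma smooth_cocoercive m x z : 0 < m -> smooth m f ->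
  f z + dotp (grad f z) (x - z) + (2 * m)^-1 * sqnorm (grad f x - grad f z)
  <= f x.
Proof.
move=> m0 fm; set a := grad f x - grad f z.
have aE : grad f x = a + grad f z by rewrite subrK.
clearbody a.
have := convex_ge_tangent z (x - m^-1 *: a).
have := fm (x - m^-1 *: a) x.
rewrite [_ - _ - x]addrAC subrr add0r [_ - _ - z]addrAC aE.
rewrite (dotpDl a) /sqnorm !(dotpNl, dotpNr, dotpZl, dotpZr) opprK.
rewrite [dotp _ (x - z - _)]dotpDr dotpNr dotpZr.
move: (dotp a a) (dotp (grad f z) a) => s D.
have -> : m / 2 * (m^-1 * (m^-1 * s)) = (2 * m)^-1 * s by field; lra.
have -> : m^-1 * s = 2 * ((2 * m)^-1 * s) by field; lra.
lra.
Qed.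

End Gradient.

(** * Optimality conditions, existence and nonexpansiveness of the proximal map *)

Section Proximal.
Context {R : realType} {d : nat}.
Variable psi : 'rV[R]_d.+1 -> \bar R.
Hypothesis psi_proper : proper_fun psi.
Hypothesis psi_convex : convex_fun psi.

(* Compare [u] with [u + t (y - u)] and let [t] tend to 0: the quadratic error
   of [phi] is of second order in [t]. *)
Lemma minimizer_variational_ineq (alpha C : R) phi u (G : 'rV[R]_d.+1) :
  0 < alpha ->
  (forall y, phi y <= phi u + dotp G (y - u) + C * sqnorm (y - u)) ->
  argmin (fun y => (alpha%:E * psi y + (phi y)%:E)%E) u ->
  exists2 r, psi u = r%:E &
    forall y, ((r - alpha^-1 * dotp G (y - u))%:E <= psi y)%E.
Proof.
move=> a0 phiu umin; case: psi_proper => psiNy [y0 y0fin].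
have [r psiu] : exists r, psi u = r%:E.
  case psiu : (psi u) => [r| |]; first by exists r.
  - have := umin y0; rewrite psiu gt0_muley ?lte_fin //.
    case psiy0 : (psi y0) => [s| |] //.
      by exfalso; apply: (psiNy y0).
  - by exfalso; apply: (psiNy u).
exists r => // y.
case psiy : (psi y) => [s| |]; first last.
- by exfalso; apply: (psiNy y).
- by rewrite leey.
rewrite lee_fin lerBlDr -(ler_pM2l a0) mulrDr mulVKf ?gt_eqF //.
apply: (@ler_lin_eps _ _ _ (C * sqnorm (y - u))) => t /andP[t0 t1].
have ut : t *: y + (1 - t) *: u - u = t *: (y - u).
  by rewrite scalerBl scale1r scalerBr -addrA [u - _]addrC addrK.
have := umin (t *: y + (1 - t) *: u).
have := psi_convex y u (introT andP (conj (ltW t0) t1)).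
rewrite psiu psiy -!EFinM -EFinD.
case: (psi _) (psiNy (t *: y + (1 - t) *: u)) => [q| |] // _.
rewrite lee_fin => qle; rewrite -EFinM -!EFinD lee_fin => umint.
have := phiu (t *: y + (1 - t) *: u).
rewrite ut /sqnorm !dotpZr dotpZl -/(sqnorm _) => phit.
have := ler_wpM2l (ltW a0) qle => aqle.
by rewrite -(ler_pM2l t0); nra.
Qed.

(* Minimizing [alpha psi u + ||u - x||^2 / 2] amounts to minimizing the
   continuous [J] over the epigraph of [psi]; the affine minorant makes the
   sublevel set of [J] in that epigraph bounded, hence compact. *)
Lemma prox_argmin (alpha : R) x y0 (G : 'rV[R]_d.+1) r0 :
  closed_fun psi -> 0 < alpha -> psi y0 = r0%:E ->
  (forall y, ((r0 - dotp G (y - y0))%:E <= psi y)%E) ->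
  argmin (fun u => (alpha%:E * psi u + (2^-1 * sqnorm (u - x)%R)%:E)%E)
    (prox alpha psi x).
Proof.
move=> psi_closed a0 psiy0 minorant; apply: xgetPex.
pose J (z : 'rV[R]_d.+1 * R) : R := alpha * z.2 + 2^-1 * sqnorm (z.1 - x).
have Jcont : continuous J.
  move=> z.
  have c2 : {for z, continuous (fun z : 'rV[R]_d.+1 * R => z.2)} by exact: cvg_snd.
  have c1 : {for z, continuous (fun z : 'rV[R]_d.+1 * R => sqnorm (z.1 - x))}.
    have c0 : {for z, continuous (fun z : 'rV[R]_d.+1 * R => z.1)} by exact: cvg_fst.
    exact: (continuous_comp c0 (@sqnorm_continuous _ _ x _)).
  have c3 : {for z, continuous (fun z : 'rV[R]_d.+1 * R => alpha * z.2)}.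
    exact: (continuousM (@cst_continuous _ _ alpha z) c2).
  have c4 : {for z,
      continuous (fun z : 'rV[R]_d.+1 * R => 2^-1 * sqnorm (z.1 - x))}.
    exact: (continuousM (@cst_continuous _ _ (2^-1 : R) z) c1).
  exact: (continuousD c3 c4).
pose K := [set z : 'rV[R]_d.+1 * R | (psi z.1 <= z.2%:E)%E] `&`
          [set z | J z <= J (y0, r0)].
have Kclosed : closed K.
  apply: closedI => //.
  apply: (@closed_comp _ _ J [set t | t <= J (y0, r0)]); last exact: closed_le.
  by move=> z _; exact: Jcont.
have Ky0 : K (y0, r0) by split; rewrite /= ?psiy0.
(* Completing the square: with the minorant inserted, [J z <= J (y0, r0)] becomes [sqnorm (u - c) <=
   sqnorm (y0 - c) = M ^+ 2]. For [lo], the minorant is split at [c] and [alpha * dotp G (u - c)] is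
   bounded by Young's inequality. *)
pose M := Num.sqrt (sqnorm (y0 - x - alpha *: G)).
pose c := x + alpha *: G.
pose lo := r0 - alpha^-1 * (2^-1 * (sqnorm (alpha *: G) + M ^+ 2)) -
           dotp G (c - y0).
have Kbounded : K `<=` [set u : 'rV[R]_d.+1 | forall i,
      `[c 0 i - M, c 0 i + M]%classic (u 0 i)] `*`
    `[lo, alpha^-1 * J (y0, r0)]%classic.
  move=> [u r] [/= psiur Jur].
  have M2 : M ^+ 2 = sqnorm (y0 - x - alpha *: G).
    by rewrite sqr_sqrtr // sqnorm_ge0.
  have := le_trans (minorant u) psiur; rewrite lee_fin => rge.
  have sq : sqnorm (u - c) <= M ^+ 2.
    rewrite M2 opprD addrA !(sqnormB (_ - x)).
    move: Jur; rewrite /J /= => Jur.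
    have : alpha * (r0 - dotp G (u - y0)) <= alpha * r by rewrite ler_wpM2l // ltW.
    have -> : u - y0 = (u - x) - (y0 - x) by rewrite opprB addrA subrK.
    rewrite dotpDr dotpNr !dotpZr !(dotpC _ G); lra.
  split => /=.
    move=> i; rewrite in_itv /= -ler_distl -(@ler_pXn2r _ 2) ?nnegrE ?sqrtr_ge0 //.
    rewrite real_normK ?num_real //; apply: le_trans sq.
    by have := sqr_coord_le_sqnorm (u - c) i; rewrite !mxE.
  rewrite in_itv /=; apply/andP; split.
    apply: le_trans rge; rewrite /lo.
    have -> : u - y0 = (u - c) + (c - y0) by rewrite addrA subrK.
    rewrite dotpDr opprD addrA lerD2r lerD2l lerN2 ler_pdivlMl //.
    have := dotp_ge_sqnorm (- (alpha *: G)) (u - c).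
    rewrite dotpNl dotpZl /sqnorm dotpNl dotpNr opprK -!/(sqnorm _); lra.
  rewrite ler_pdivlMl //; apply: le_trans Jur; rewrite /J /= lerDl.
  by rewrite mulr_ge0 // sqnorm_ge0.
have Kcompact : compact K.
  apply: subclosed_compact Kclosed _ Kbounded.
  apply: compact_setX; last exact: segment_compact.
  apply: (@rV_compact _ _ (fun i => `[c 0 i - M, c 0 i + M]%classic)) => i.
  exact: segment_compact.
have [[u r] /set_mem[/= psiur Jur] umin] := compact_EVT_min
  (ex_intro _ _ Ky0) Kcompact (continuous_subspaceT Jcont).
exists u => y.
have psiNy : psi y != -oo%E.
  by rewrite -ltNye; exact: lt_le_trans (ltNyr _) (minorant y).
case psiy : (psi y) => [s| |]; last by rewrite psiy in psiNy.
  (* The minimum over [K] is global on the epigraph: a competitor outside the sublevel set has [J]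
     above [J (y0, r0)]. *)
  have J_le : J (u, r) <= J (y, s).
    have [Jys|/ltW] := leP (J (y, s)) (J (y0, r0)); last exact: le_trans.
    by apply: umin; rewrite inE; split; rewrite /= ?psiy.
  apply: (@le_trans _ _ (J (u, r))%:E); last by rewrite -EFinM -EFinD lee_fin.
  by rewrite EFinD leeD2r // EFinM lee_pmul2l.
by rewrite gt0_muley ?lte_fin // addye // leey.
Qed.

(** The minorant makes [- G] a subgradient at [y0], so [y0] is the proximal point of
    [y0 - alpha *: G]. With [u] the proximal point of [x], the subgradient inequalities at [u] and
    [y0] add up to [sqnorm (u - y0) <= dotp (x - (y0 - alpha *: G)) (u - y0)]. *)
Lemma prox_nonexpansive_at (alpha : R) x y0 (G : 'rV[R]_d.+1) r0 :
  closed_fun psi -> 0 < alpha -> psi y0 = r0%:E ->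
  (forall y, ((r0 - dotp G (y - y0))%:E <= psi y)%E) ->
  sqnorm (prox alpha psi x - y0) <= sqnorm (x - (y0 - alpha *: G)).
Proof.
move=> psi_closed a0 psiy0 minorant.
have umin := prox_argmin x psi_closed a0 psiy0 minorant.
move: (prox alpha psi x) umin => u umin.
(* Half the squared distance to [x] equals its expansion at [u], with gradient [u - x] and
   [C = 1/2]. *)
have [|r psiu /(_ y0)] := minimizer_variational_ineq (C := 2^-1) a0
    (phi := fun u => 2^-1 * sqnorm (u - x)) (G := u - x) _ umin.
  move=> y; have -> : y - x = (y - u) + (u - x) by rewrite addrA subrK.
  rewrite /sqnorm !dotpE !(dotpC y) !(dotpC x u) -!/(sqnorm _); lra.
rewrite psiy0 lee_fin => ule.
have := minorant u; rewrite psiu lee_fin => y0le.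
apply: sqnorm_le_of_dotp.
have {ule y0le} : - (alpha^-1 * dotp (u - x) (y0 - u)) <= dotp G (u - y0).
  by lra.
rewrite -(ler_pM2l a0) mulrN mulVKf ?gt_eqF // -dotpNr opprB.
have -> : u - x = (u - y0) - (x - y0) by rewrite opprB addrA subrK.
have -> : x - (y0 - alpha *: G) = (x - y0) + alpha *: G by rewrite opprB addrCA addrC.
move: (u - y0) => v; rewrite /sqnorm [dotp (v - _) v]dotpDl dotpNl.
rewrite [dotp (_ + alpha *: G) v]dotpDl dotpZl; lra.
Qed.

End Proximal.

(** * Scalar inequalities behind the contraction *)

(** The left side is the mean square of one coordinate of [g - gs]. After multiplication by [delta]
    the gap is exactly [(a + (1 - delta) w)^2 + delta (3 - delta) w^2]. *)
Lemma estimator_variance_le (R : realFieldType) (delta a w : R) :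
  0 < delta -> delta <= 1 ->
  (1 - delta) * w ^+ 2 + delta * (delta^-1 * a - (delta^-1 - 1) * w) ^+ 2
  <= 2 / delta * (a ^+ 2 + w ^+ 2).
Proof.
move=> d0 d1; rewrite -(ler_pM2l d0).
have -> : delta * ((1 - delta) * w ^+ 2 +
    delta * (delta^-1 * a - (delta^-1 - 1) * w) ^+ 2) =
    delta * (1 - delta) * w ^+ 2 + (a - (1 - delta) * w) ^+ 2 by field; lra.
have -> : delta * (2 / delta * (a ^+ 2 + w ^+ 2)) = 2 * (a ^+ 2 + w ^+ 2).
  by field; lra.
have : 0 <= (a + (1 - delta) * w) ^+ 2 by exact: sqr_ge0.
have : delta * (3 - delta) * w ^+ 2 >= 0.
  by rewrite mulr_ge0 ?sqr_ge0 // mulr_ge0; lra.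
nra.
Qed.

(** The weight [1 / (2 p)] makes the refreshed memory cost half of [alpha / m * a^2]. The stepsize
    bounds the variance by [alpha / (2 m) * (1 - alpha sigma / p) * (a^2 + w^2)]: its [a^2] part
    fits in the other half, and the [w^2] terms add up exactly to the contracted memory. *)
Lemma coordinate_contraction (R : realFieldType) (alpha m sigma delta p a w : R) :
  0 < alpha -> 0 < m -> 0 < sigma -> 0 < delta -> delta <= 1 -> 0 < p ->
  alpha * (4 * (m / delta) + sigma / p) <= 1 ->
  alpha ^+ 2 * ((1 - delta) * w ^+ 2 +
     delta * (delta^-1 * a - (delta^-1 - 1) * w) ^+ 2) +
  alpha / m * ((2 * p)^-1 * (p * a ^+ 2 + (1 - p) * w ^+ 2))
  <= alpha / m * a ^+ 2 +
     (1 - alpha * sigma) * (alpha / m * ((2 * p)^-1 * w ^+ 2)).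
Proof.
move=> a0 m0 s0 d0 d1 p0 ale.
have var := estimator_variance_le a w d0 d1.
have {}var := ler_wpM2l (sqr_ge0 alpha) var.
apply: le_trans (lerD var (lexx _)) _.
have ale' : 2 * alpha / delta <= (2 * m)^-1 * (1 - alpha * sigma / p).
  rewrite -(ler_pM2l (_ : 0 < 2 * m)); last by lra.
  rewrite mulVKf; last by lra.
  have -> : 2 * m * (2 * alpha / delta) = alpha * (4 * (m / delta)) by field; lra.
  by rewrite -mulrA; lra.
have e1 : alpha ^+ 2 * (2 / delta * (a ^+ 2 + w ^+ 2)) =
    (2 * alpha / delta) * (alpha * (a ^+ 2 + w ^+ 2)) by ring.
have t0 : 0 <= alpha * (a ^+ 2 + w ^+ 2).
  by rewrite mulr_ge0 ?addr_ge0 ?sqr_ge0 // ltW.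
have := ler_wpM2r t0 ale'; rewrite e1 => {e1 t0 var ale' ale} H.
apply: le_trans (lerD H (lexx _)) _.
rewrite -subr_ge0.
have -> : alpha / m * a ^+ 2 +
    (1 - alpha * sigma) * (alpha / m * ((2 * p)^-1 * w ^+ 2)) -
   ((2 * m)^-1 * (1 - alpha * sigma / p) * (alpha * (a ^+ 2 + w ^+ 2)) +
    alpha / m * ((2 * p)^-1 * (p * a ^+ 2 + (1 - p) * w ^+ 2))) =
   (2 * m)^-1 * (alpha * sigma / p) * (alpha * a ^+ 2) by field; lra.
apply: mulr_ge0; last by rewrite mulr_ge0 ?sqr_ge0 // ltW.
by apply/ltW; rewrite !(mulr_gt0, invr_gt0).
Qed.

(** * Expected decrease of the Lyapunov function in one iteration *)

Section OneStep.
Context {R : realType} {d : nat}.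
Variables (f : 'rV[R]_d.+1 -> R) (psi : 'rV[R]_d.+1 -> \bar R).
Variables (xstar : 'rV[R]_d.+1) (m sigma delta alpha : R).
Variables (p : 'I_d.+1 -> R) (b : 'rV[R]_d.+1) (rho : {set 'I_d.+1} -> R).
Hypothesis m_gt0 : 0 < m.
Hypothesis sigma_gt0 : 0 < sigma.
Hypothesis delta_gt0 : 0 < delta.
Hypothesis delta_le1 : delta <= 1.
Hypothesis alpha_gt0 : 0 < alpha.
Hypothesis p_gt0 : forall i, 0 < p i.
Hypothesis alpha_le : forall i, alpha * (4 * (m / delta) + sigma / p i) <= 1.
Hypothesis b_sqr : forall i, b 0 i ^+ 2 = (2 * p i)^-1.
Hypothesis rho_sum : \sum_S rho S = 1.
Hypothesis rho_in : forall i, \sum_(S : {set 'I_d.+1} | i \in S) rho S = p i.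
Hypothesis grad_monotone : forall x,
  (2 * m)^-1 * sqnorm (grad f x - grad f xstar) + sigma / 2 * sqnorm (x - xstar)
  <= dotp (grad f x - grad f xstar) (x - xstar).
Hypothesis prox_nonexp : forall x,
  sqnorm (prox alpha psi x - xstar) <=
  sqnorm (x - (xstar - alpha *: grad f xstar)).

(** Law of the coin; [rho] is the law of the subset, so sums weighted by [wt * rho] are expectations
    over one step from a fixed state. *)
Let wt (c : bool) : R := if c then delta else 1 - delta.
Let gs := grad f xstar.

(** The coin affects only the new [x] and the subset only the new [h], so the two parts of the
    Lyapunov function average separately. *)
Lemma expected_sum (N : bool -> R) (M : {set 'I_d.+1} -> R) :
  \sum_(v : bool * {set 'I_d.+1}) wt v.1 * rho v.2 * (N v.1 + M v.2) =
  \sum_c wt c * N c + \sum_S rho S * M S.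
Proof.
rewrite -(pair_bigA _ (fun c S => wt c * rho S * (N c + M S))) /=.
rewrite (eq_bigr (fun c => wt c * N c + wt c * \sum_S rho S * M S)); last first.
  move=> c _; rewrite -[in RHS](mulr1 (_ * N c)) -rho_sum !mulr_sumr -big_split /=.
  by apply: eq_bigr => S _; ring.
rewrite big_split -mulr_suml /=; congr (_ + _).
have -> : \sum_c wt c = 1 by rewrite big_bool /= addrC subrK.
by rewrite mul1r.
Qed.

Lemma expected_coordinate_update i (a w : R) :
  \sum_S rho S * (if i \in S then a else w) = p i * a + (1 - p i) * w.
Proof.
rewrite (bigID (fun S : {set 'I_d.+1} => i \in S)) /=.
rewrite -rho_in [in RHS]mulr_suml.
have -> : 1 - \sum_(S : {set 'I_d.+1} | i \in S) rho S =
    \sum_(S : {set 'I_d.+1} | i \notin S) rho S.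
  rewrite -rho_sum [X in X - _](bigID (fun S : {set 'I_d.+1} => i \in S)) /=.
  by rewrite addrAC subrr add0r.
rewrite mulr_suml; congr (_ + _); apply: eq_bigr => S.
  by move=> ->.
by move=> /negbTE ->.
Qed.

Lemma svrcd_inv_step_snd c S x h i :
  (svrcd_inv_step f psi alpha delta c S (x, h)).2 0 i =
  if i \in S then grad f x 0 i else h 0 i.
Proof.
rewrite /=; move: (grad f x) => u; rewrite mxE summxE.
have -> : \sum_(j in S) ((u 0 j - h 0 j) *: delta_mx 0 j : 'rV_d.+1) 0 i =
          if i \in S then u 0 i - h 0 i else 0.
  under eq_bigr => j _ do rewrite !mxE eqxx /=.
  case: ifP => iS.
    rewrite (bigD1 i) //= eqxx mulr1 big1 ?addr0 // => j /andP[_ /negbTE ji].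
    by rewrite eq_sym ji mulr0.
  rewrite big1 // => j jS; case: eqP => [ij|_]; last by rewrite mulr0.
  by rewrite ij jS in iS.
by case: ifP => _; rewrite ?addr0 // addrC subrK.
Qed.

(** The first component of the step ignores the subset; the empty set is a placeholder. *)
Lemma expected_prox_step x h :
  \sum_c wt c *
    sqnorm ((svrcd_inv_step f psi alpha delta c finset.set0 (x, h)).1 - xstar) <=
  sqnorm (x - xstar) - 2 * alpha * dotp (grad f x - gs) (x - xstar) +
  \sum_i alpha ^+ 2 * ((1 - delta) * (h 0 i - gs 0 i) ^+ 2 +
    delta * (delta^-1 * (grad f x 0 i - gs 0 i) -
             (delta^-1 - 1) * (h 0 i - gs 0 i)) ^+ 2).
Proof.
pose a := grad f x - gs; pose w := h - gs.
pose q := delta^-1 *: a - (delta^-1 - 1) *: w.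
have subE (u v : 'rV[R]_d.+1) i : u 0 i - v 0 i = (u - v) 0 i by rewrite !mxE.
under [X in _ <= _ + X]eq_bigr => i _ do rewrite !subE -/a -/w.
rewrite big_bool.
have wt1 : 0 <= wt true by rewrite /wt ltW.
have wt2 : 0 <= wt false by rewrite /wt subr_ge0.
apply: le_trans (lerD (ler_wpM2l wt1 (prox_nonexp _)) (ler_wpM2l wt2 (prox_nonexp _))) _.
rewrite /= -/gs.
have -> : x - alpha *: ((1 / delta) *: grad f x - (1 / delta - 1) *: h) -
    (xstar - alpha *: gs) = x - xstar - alpha *: q.
  apply/rowP => i; rewrite /q /a /w /gs; move: (grad f x) (grad f xstar) => u v.
  rewrite !mxE; ring.
have -> : x - alpha *: h - (xstar - alpha *: gs) = x - xstar - alpha *: w.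
  apply/rowP => i; rewrite /w /gs; move: (grad f xstar) => v.
  rewrite !mxE; ring.
rewrite -/a /q; clearbody a w; move: (x - xstar) => z.
(* Equality from here on: [delta * q + (1 - delta) * w = a], that is, the estimator is unbiased, so
   the cross terms collapse. *)
rewrite le_eqVlt; apply/orP; left; apply/eqP.
rewrite /wt !sqnormE /dotp !mulr_sumr -sumrN -!big_split /=.
apply: eq_bigr => i _; rewrite !mxE; field.
by rewrite gt_eqF.
Qed.

Lemma expected_lyapunov_step xh :
  \sum_(v : bool * {set 'I_d.+1}) wt v.1 * rho v.2 *
     lyapunov f alpha m b xstar (svrcd_inv_step f psi alpha delta v.1 v.2 xh)
  <= (1 - alpha * sigma) * lyapunov f alpha m b xstar xh.
Proof.
case: xh => x h.
pose N c := sqnorm ((svrcd_inv_step f psi alpha delta c finset.set0 (x, h)).1 - xstar).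
pose M (S : {set 'I_d.+1}) := alpha / m * \sum_i b 0 i ^+ 2 *
  (if i \in S then (grad f x 0 i - gs 0 i) ^+ 2 else (h 0 i - gs 0 i) ^+ 2).
have lyE c S : lyapunov f alpha m b xstar
    (svrcd_inv_step f psi alpha delta c S (x, h)) = N c + M S.
  rewrite /lyapunov; congr (_ + _ * _); apply: eq_bigr => i _.
  by rewrite svrcd_inv_step_snd; case: ifP.
under eq_bigr => v _ do rewrite lyE.
rewrite expected_sum.
have -> : \sum_S rho S * M S = \sum_i alpha / m * ((2 * p i)^-1 *
    (p i * (grad f x 0 i - gs 0 i) ^+ 2 + (1 - p i) * (h 0 i - gs 0 i) ^+ 2)).
  rewrite /M (eq_bigr (fun S => \sum_i alpha / m * (b 0 i ^+ 2 * (rho S *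
    (if i \in S then (grad f x 0 i - gs 0 i) ^+ 2 else (h 0 i - gs 0 i) ^+ 2))))).
    rewrite exchange_big; apply: eq_bigr => i _ /=.
    by rewrite -!mulr_sumr expected_coordinate_update b_sqr.
  by move=> S _; rewrite !mulr_sumr; apply: eq_bigr => i _;
    rewrite mulrCA (mulrCA (rho S)).
apply: le_trans (lerD (expected_prox_step x h) (lexx _)) _.
rewrite -addrA -big_split /=.
have := grad_monotone x => mono.
(* Scaled by [2 * alpha], the gradient term pays for the coordinatewise bound and the distance term
   gives the factor [1 - alpha * sigma]. *)
have {}mono := ler_wpM2l (_ : 0 <= 2 * alpha) mono.
have {}mono := mono (mulr_ge0 (ler0n _ _) (ltW alpha_gt0)).
have H : \sum_i (alpha ^+ 2 * ((1 - delta) * (h 0 i - gs 0 i) ^+ 2 +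
    delta * (delta^-1 * (grad f x 0 i - gs 0 i) -
             (delta^-1 - 1) * (h 0 i - gs 0 i)) ^+ 2) +
    alpha / m * ((2 * p i)^-1 *
    (p i * (grad f x 0 i - gs 0 i) ^+ 2 + (1 - p i) * (h 0 i - gs 0 i) ^+ 2))) <=
   alpha / m * sqnorm (grad f x - gs) + (1 - alpha * sigma) *
     (alpha / m * \sum_i b 0 i ^+ 2 * (h 0 i - gs 0 i) ^+ 2).
  rewrite sqnormE !mulr_sumr -big_split; apply: ler_sum => i _ /=.
  by rewrite !mxE b_sqr; exact: coordinate_contraction.
apply: le_trans (lerD (lexx _) H) _.
rewrite /lyapunov /= -/gs.
move: mono; rewrite mulrDr.
have -> : 2 * alpha * ((2 * m)^-1 * sqnorm (grad f x - grad f xstar)) =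
          alpha / m * sqnorm (grad f x - gs) by rewrite /gs; field; rewrite gt_eqF.
rewrite -/gs; lra.
Qed.

End OneStep.

(** * Expectations along a chain driven by independent finite noise *)

Section FiniteNoiseChain.
Context {R : realType} {disp : measure_display} {T : measurableType disp}.
Variable P : probability T R.
Variables (St : Type) (V W : finType).
Variables (Y : nat -> T -> V) (Z : nat -> T -> W).
Variables (step : V -> W -> St -> St) (state : nat -> T -> St) (s0 : St).
Hypothesis state0 : forall t, state 0 t = s0.
Hypothesis stateS : forall k t, state k.+1 t = step (Y k t) (Z k t) (state k t).
Hypothesis Y_rv : forall k, discrete_rv (Y k).
Hypothesis Z_rv : forall k, discrete_rv (Z k).

Let noise (i : nat + nat) : set (set T) :=
  match i with inl k => events_of (Y k) | inr k => events_of (Z k) end.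
Hypothesis noise_indep : mutually_independent P noise.

Let time (i : nat + nat) := match i with inl k => k | inr k => k end.
(** Fixes all the noise of step [k]; for fixed [k] these finitely many events partition [T]. *)
Let cell k (v : V * W) := Y k @^-1` [set v.1] `&` Z k @^-1` [set v.2].

Let noise_measurable i A : noise i A -> measurable A.
Proof. by case: i => k; [exact: Y_rv|exact: Z_rv]. Qed.

Let cell_measurable k v : measurable (cell k v).
Proof.
by apply: measurableI; [apply: Y_rv|apply: Z_rv]; eexists; split.
Qed.

Let bigcap_noise_measurable (J : seq (nat + nat)) A :
  (forall i, i \in J -> noise i (A i)) -> measurable (\bigcap_(i in [set` J]) A i).
Proof.
move=> JA; apply: fin_bigcap_measurable => // i /= iJ.
exact: noise_measurable (JA i iJ).
Qed.

(** [St] carries no sigma-algebra: each state takes finitely many values, and its preimages are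
    finite unions over noise cells. *)
Lemma state_preimage_measurable k (B : set St) : measurable (state k @^-1` B).
Proof.
elim: k B => [|k IH] B.
  have [Bs0|Bs0] := pselect (B s0).
    rewrite (_ : _ @^-1` _ = setT) //; apply/seteqP; split=> // t _.
    by rewrite /preimage /= state0.
  rewrite (_ : _ @^-1` _ = set0) //; apply/seteqP; split=> // t.
  by rewrite /preimage /= state0.
rewrite (_ : _ @^-1` _ = \bigcup_(v in [set: V * W])
    (cell k v `&` state k @^-1` [set s | B (step v.1 v.2 s)])).
  apply: fin_bigcup_measurable; first exact: finite_finset.
  by move=> v _; apply: measurableI.
apply/seteqP; split=> [t Bt|t [v _ [[/= <- <-]]]].
  by exists (Y k t, Z k t); rewrite /cell //= -stateS.
by rewrite /preimage /= stateS.
Qed.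

Lemma state_measurable_fun k (G : St -> R) D :
  measurable_fun D (fun t => (G (state k t))%:E).
Proof.
move=> mD B mB; apply: measurableI => //.
exact: (state_preimage_measurable k [set s | B (G s)%:E]).
Qed.

Let integral_cells k l (G : St -> R) D : (forall s, 0 <= G s) -> measurable D ->
  (\int[P]_(t in D) (G (state l t))%:E =
   \sum_(v : V * W) \int[P]_(t in D `&` cell k v) (G (state l t))%:E)%E.
Proof.
move=> G0 mD.
have DE : D = \big[setU/set0]_(v <- enum {: V * W}) (D `&` cell k v).
  rewrite -bigcup_seq; apply/seteqP; split=> [t Dt|t [v _ []//]].
  by exists (Y k t, Z k t) => //=; rewrite mem_enum.
rewrite {1}DE ge0_integral_bigsetU ?big_enum //.
- by move=> v; apply: measurableI.
- exact: enum_uniq.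
- by move=> [v w] [v' w'] _ _ [t [[_ [/= <- <-]] [_ [/= <- <-]]]].
- exact: state_measurable_fun.
- by move=> t _; rewrite lee_fin.
Qed.

(** Independence of the state at time [k] from noise of times at least [k], phrased through
    integrals over finite intersections of noise events. *)
Let indep_of_future k := forall (G : St -> R) (J : seq (nat + nat)) A,
  (forall s, 0 <= G s) -> uniq J -> (forall i, i \in J -> (k <= time i)%N) ->
  (forall i, i \in J -> noise i (A i)) ->
  (\int[P]_(t in \bigcap_(i in [set` J]) A i) (G (state k t))%:E =
   (\prod_(i <- J) P (A i)) * \int[P]_t (G (state k t))%:E)%E.

Let integral_state_step k (G : St -> R) (J : seq (nat + nat)) A :
  indep_of_future k -> (forall s, 0 <= G s) -> uniq J ->
  (forall i, i \in J -> (k < time i)%N) ->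
  (forall i, i \in J -> noise i (A i)) ->
  (\int[P]_(t in \bigcap_(i in [set` J]) A i) (G (state k.+1 t))%:E =
   (\prod_(i <- J) P (A i)) * \sum_(v : V * W)
     (P (Y k @^-1` [set v.1]) * P (Z k @^-1` [set v.2])) *
     \int[P]_t (G (step v.1 v.2 (state k t)))%:E)%E.
Proof.
move=> IH G0 uJ kJ JA.
rewrite (integral_cells k) //; last exact: bigcap_noise_measurable.
rewrite ge0_sume_distrr; last first.
  move=> v _; rewrite mule_ge0 ?mule_ge0 //.
  by apply: integral_ge0 => t _; rewrite lee_fin.
apply: eq_bigr => v _.
(* The family [A] enlarged by the two events of time [k]. Their indices are not in [J], whose times
   exceed [k], so the hypothesis at [k] applies to [J] with both added. *)
pose B' i := match i with
  | inl l => if l == k then Y k @^-1` [set v.1] else A i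
  | inr l => if l == k then Z k @^-1` [set v.2] else A i
  end.
have lk : inl k \notin J by apply/negP => /kJ /=; rewrite ltnn.
have rk : inr k \notin J by apply/negP => /kJ /=; rewrite ltnn.
have B'E i : i \in J -> B' i = A i.
  by case: i => l lJ /=; case: eqP => // lE;
    move: lJ; rewrite lE ?(negbTE lk) ?(negbTE rk).
have := IH (fun s => G (step v.1 v.2 s)) [:: inl k, inr k & J] B'.
rewrite !big_cons /= !eqxx (eq_big_seq _ (fun i iJ => congr1 P (B'E i iJ))).
have capE : \bigcap_(i in [set` [:: inl k, inr k & J]]) B' i =
    \bigcap_(i in [set` J]) A i `&` cell k v.
  apply/seteqP; split=> [t Bt|t [Bt [Yt Zt]] i /=].
    split; first by move=> i iJ; rewrite -B'E //; apply: Bt; rewrite /= !inE iJ !orbT.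
    split.
      by have := Bt (inl k); rewrite /= eqxx; apply; rewrite /= !inE eqxx.
    by have := Bt (inr k); rewrite /= eqxx; apply; rewrite /= !inE eqxx orbT.
  rewrite !inE => /or3P[/eqP ->|/eqP ->|iJ]; rewrite /= ?eqxx //.
  by rewrite B'E //; exact: Bt.
rewrite capE => IHk.
transitivity (\int[P]_(t in \bigcap_(i in [set` J]) A i `&` cell k v)
    (G (step v.1 v.2 (state k t)))%:E)%E.
  by apply: eq_integral => t; rewrite inE => -[_ [/= <- <-]]; rewrite stateS.
rewrite IHk //.
- by rewrite [in RHS]muleA; congr (_ * _)%E; rewrite muleA muleC.
- by rewrite inE negb_or lk rk uJ.
- by move=> i; rewrite !inE => /or3P[/eqP ->|/eqP ->|/kJ /ltnW] //=.
- move=> i; rewrite !inE => /or3P[/eqP ->|/eqP ->|iJ]; rewrite /= ?eqxx.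
  + by exists [set v.1].
  + by exists [set v.2].
  + by rewrite B'E //; exact: JA.
Qed.

Let integral_state_succ_of_indep k (G : St -> R) :
  indep_of_future k -> (forall s, 0 <= G s) ->
  (\int[P]_t (G (state k.+1 t))%:E =
   \sum_(v : V * W) (P (Y k @^-1` [set v.1]) * P (Z k @^-1` [set v.2])) *
     \int[P]_t (G (step v.1 v.2 (state k t)))%:E)%E.
Proof.
move=> IH G0.
have := integral_state_step (A := fun=> setT) IH G0 (isT : uniq [::]).
by rewrite big_nil mul1e set_nil bigcap_set0 => ->.
Qed.

(** At time 0 the state is constant and this is mutual independence. In the step, the sum over noise
    values is the same for [J] and for the empty family, so the product factors out. *)
Lemma state_indep_of_future_noise k : indep_of_future k.
Proof.
elim: k => [|k IH] G J A G0 uJ kJ JA.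
  under eq_integral => t _ do rewrite state0.
  under [X in (_ * X)%E]eq_integral => t _ do rewrite state0.
  rewrite !integral_cst //; last exact: bigcap_noise_measurable.
  have -> : (P : {measure set T -> \bar R}) setT = 1%E by exact: probability_setT.
  by rewrite mule1 muleC; congr (_ * _)%E; exact: noise_indep.
rewrite integral_state_step //; congr (_ * _)%E.
by rewrite integral_state_succ_of_indep.
Qed.

Lemma integral_state_succ k (G : St -> R) : (forall s, 0 <= G s) ->
  (\int[P]_t (G (state k.+1 t))%:E =
   \sum_(v : V * W) (P (Y k @^-1` [set v.1]) * P (Z k @^-1` [set v.2])) *
     \int[P]_t (G (step v.1 v.2 (state k t)))%:E)%E.
Proof. exact/integral_state_succ_of_indep/state_indep_of_future_noise. Qed.

Lemma expectation_state_contraction (kappa : R) (py : V -> R) (pz : W -> R)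
    (G : St -> R) k :
  (forall l v, P (Y l @^-1` [set v]) = (py v)%:E) ->
  (forall l w, P (Z l @^-1` [set w]) = (pz w)%:E) ->
  (forall s, 0 <= G s) -> 0 <= kappa ->
  (forall s, \sum_(v : V * W) py v.1 * pz v.2 * G (step v.1 v.2 s) <= kappa * G s) ->
  ('E_P[fun t => G (state k t)] <= (kappa ^+ k * G s0)%:E)%E.
Proof.
move=> pyE pzE G0 kappa0 Gstep; rewrite unlock.
have py0 v : 0 <= py v by rewrite -lee_fin -(pyE 0).
have pz0 w : 0 <= pz w by rewrite -lee_fin -(pzE 0).
elim: k => [|k IH].
  under eq_integral => t _ do rewrite state0.
  rewrite integral_cst // expr0 mul1r.
  have -> : (P : {measure set T -> \bar R}) setT = 1%E by exact: probability_setT.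
  by rewrite mule1.
rewrite integral_state_succ //.
(* The probabilities move inside the integral so that the one-step bound applies pointwise to the
   sum. *)
have scale v : (P (Y k @^-1` [set v.1]) * P (Z k @^-1` [set v.2]) *
      \int[P]_t (G (step v.1 v.2 (state k t)))%:E =
    \int[P]_t ((py v.1 * pz v.2 * G (step v.1 v.2 (state k t)))%:E))%E.
  rewrite pyE pzE -EFinM -ge0_integralZl_EFin ?mulr_ge0 //.
  - by move=> t _; rewrite lee_fin.
  - exact: (state_measurable_fun k (fun s => G (step v.1 v.2 s))).
rewrite (eq_bigr _ (fun v _ => scale v)).
rewrite -ge0_integral_sum //=; last 2 first.
- move=> v; apply: (state_measurable_fun k
    (fun s => py v.1 * pz v.2 * G (step v.1 v.2 s))).
- by move=> v t _; rewrite lee_fin !mulr_ge0.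
under eq_integral => t _ do rewrite sumEFin.
apply: (@le_trans _ _ (\int[P]_t (kappa%:E * (G (state k t))%:E))%E).
  apply: ge0_le_integral => //.
  - by move=> t _; rewrite lee_fin sumr_ge0 // => v _; rewrite !mulr_ge0.
  - exact: (state_measurable_fun k
      (fun s => \sum_(v : V * W) py v.1 * pz v.2 * G (step v.1 v.2 s))).
  - exact: (state_measurable_fun k (fun s => kappa * G s)).
  - by move=> t _; rewrite lee_fin.
rewrite ge0_integralZl_EFin //; last 2 first.
- by move=> t _; rewrite lee_fin.
- exact: state_measurable_fun.
by rewrite exprS -mulrA EFinM lee_wpmul2l.
Qed.

End FiniteNoiseChain.

(** * Finite laws, the geometric rate and the final assembly *)

Section DiscreteLaw.
Context {R : realType} {disp : measure_display} {T : measurableType disp}.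
Variable P : probability T R.

Lemma sum_discrete_law (W : finType) (X : T -> W) (B : {pred W}) :
  discrete_rv X ->
  \sum_(w in B) fine (P (X @^-1` [set w])) = fine (P [set t | X t \in B]).
Proof.
move=> X_rv.
have mX w : measurable (X @^-1` [set w]) by apply: X_rv; exists [set w].
have -> : [set t | X t \in B] = \bigcup_(w in [set` enum B]) (X @^-1` [set w]).
  apply/seteqP; split=> [t /= Bt|t [w /=]]; last by rewrite mem_enum => ? ->.
  by exists (X t); rewrite /= ?mem_enum.
rewrite measure_fin_bigcup //; last by move=> w w' _ _ [t [/= <- <-]].
rewrite -fsbig_seq ?enum_uniq // -[LHS]big_enum /=.
by rewrite sum_fine // => w _; exact: fin_num_measure.
Qed.

End DiscreteLaw.

(** Uses [1 - r <= exp (- r)]; then [r * k >= r * Q * ln (1 / eps) >= ln (1 / eps)], as the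
    logarithm is positive. *)
Lemma geometric_rate (R : realType) (r Q eps : R) k :
  0 <= r <= 1 -> 1 <= r * Q -> 0 < eps -> eps < 1 -> Q * ln (1 / eps) <= k%:R ->
  (1 - r) ^+ k <= eps.
Proof.
move=> /andP[r0 r1] rQ e0 e1 kQ.
apply: (@le_trans _ _ (expR (- r) ^+ k)).
  by apply: lerXn2r; rewrite ?nnegrE ?subr_ge0 ?expR_ge0 // expR_ge1Dx.
rewrite -expRM_natr -[leRHS](lnK (_ : eps \is Num.pos)) // ler_expR.
have L0 : 0 < ln (1 / eps) by rewrite ln_gt0 // div1r invf_gt1.
rewrite mulNr lerNl -lnV ?posrE // -div1r.
apply: le_trans (ler_wpM2l r0 kQ); rewrite mulrA ler_peMl //; exact: ltW.
Qed.

(** Cocoercivity and quasi strong convexity are added; the values of [f] cancel. *)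
Lemma grad_monotone_at (R : realType) (d : nat) (f : 'rV[R]_d.+1 -> R)
    (m sigma : R) (xstar x : 'rV[R]_d.+1) :
  (forall x, differentiable f x) ->
  convex_function [set: 'rV[R]_d.+1] f -> 0 < m -> smooth m f ->
  quasi_strongly_convex sigma f xstar ->
  (2 * m)^-1 * sqnorm (grad f x - grad f xstar) + sigma / 2 * sqnorm (x - xstar)
  <= dotp (grad f x - grad f xstar) (x - xstar).
Proof.
move=> fd fc m0 fm fq.
have := smooth_cocoercive fd fc x xstar m0 fm; have := fq x.
have -> : dotp (grad f x) (xstar - x) = - dotp (grad f x) (x - xstar).
  by rewrite -dotpNr opprB.
rewrite (dotpDl (grad f x)) dotpNl; lra.
Qed.

Theorem corollaryK3 (R : realType) (d : nat)
    (f : 'rV[R]_d.+1 -> R) (psi : 'rV[R]_d.+1 -> \bar R)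
    (xstar : 'rV[R]_d.+1) (m sigma delta alpha : R)
    (disp : measure_display) (T : measurableType disp) (P : probability T R)
    (L : T -> {set 'I_d.+1})
    (coin : nat -> T -> bool) (Ls : nat -> T -> {set 'I_d.+1})
    (x0 h0 : 'rV[R]_d.+1)
    (f_diff : forall x, differentiable f x)
    (f_convex : convex_function [set: 'rV[R]_d.+1] f)
    (psi_proper : proper_fun psi)
    (psi_closed : closed_fun psi)
    (psi_convex : convex_fun psi)
    (xstar_min : argmin (fun x => ((f x)%:E + psi x)%E) = [set xstar])
    (sigma_gt0 : 0 < sigma)
    (f_qsc : quasi_strongly_convex sigma f xstar)
    (m_gt0 : 0 < m)
    (f_smooth : smooth m f)
    (delta_gt0 : 0 < delta)
    (delta_le1 : delta <= 1)
    (L_rv : discrete_rv L)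
    (p_gt0 : forall i, 0 < inclusion_prob P L i)
    (random : svrcd_inv_randomness P delta L coin Ls)
    (alphaE : alpha =
       fin_min (fun i => 1 / (4 * (m / delta) + sigma / inclusion_prob P L i))) :
  exists b : 'rV[R]_d.+1,
    (forall i, 0 < b 0 i) /\
    forall (eps : R) (k : nat), 0 < eps -> eps < 1 ->
      fin_max (fun i => 4 * (m / (sigma * delta)) + 1 / inclusion_prob P L i)
        * ln (1 / eps) <= k%:R ->
      ('E_P[fun t => lyapunov f alpha m b xstar
                       (svrcd_inv f psi alpha delta coin Ls x0 h0 k t)]
       <= (eps * lyapunov f alpha m b xstar (x0, h0))%:E)%E.
Proof.
have xsm : argmin (fun x => ((f x)%:E + psi x)%E) xstar by rewrite xstar_min.
(* Optimality of [xstar] for [f + psi]: smoothness at [xstar] is the required quadratic bound, and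
   [- grad f xstar] becomes a subgradient of [psi]. *)
have [r0 psix minorant] : exists2 r, psi xstar = r%:E &
    forall y, ((r - dotp (grad f xstar) (y - xstar))%:E <= psi y)%E.
  have [|r psix min] := minimizer_variational_ineq psi_proper psi_convex
    (ltr01 : 0 < 1 :> R) (f_smooth ^~ xstar).
    by move=> y; rewrite !mul1e ![(psi _ + _)%E]addeC; exact: xsm.
  by exists r => // y; have := min y; rewrite invr1 mul1r.
pose p := inclusion_prob P L.
(* The [i]-th complexity term is [c i / sigma] and the [i]-th candidate stepsize is [1 / c i]; hence
   [alpha * sigma * Q >= 1]. *)
pose Q := fin_max (fun i => 4 * (m / (sigma * delta)) + 1 / p i).
pose c i := 4 * (m / delta) + sigma / p i.
have c0 i : 0 < c i by rewrite addr_gt0 // ?mulr_gt0 ?invr_gt0.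
have termE i : 4 * (m / (sigma * delta)) + 1 / p i = c i / sigma.
  by rewrite /c; field; rewrite !gt_eqF // p_gt0.
have cQ i : c i <= sigma * Q.
  have := le_bigmax (4 * (m / (sigma * delta)) + 1 / p ord0)
    (fun i => 4 * (m / (sigma * delta)) + 1 / p i) i; rewrite -/Q termE.
  by rewrite ler_pdivrMr // mulrC.
have sQ0 : 0 < sigma * Q by apply: lt_le_trans (cQ ord0).
have alphaQ : (sigma * Q)^-1 <= alpha.
  have Fge i : (sigma * Q)^-1 <= 1 / c i by rewrite div1r lef_pV2 ?posrE.
  (* The default of the minimum, its entry at [ord0], obeys the same bound. *)
  by rewrite alphaE; apply: le_bigmin => [|i _]; exact: Fge.
have a0 : 0 < alpha by apply: lt_le_trans alphaQ; rewrite invr_gt0.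
have aQ : 1 <= alpha * sigma * Q by rewrite -mulrA -ler_pdivrMr // div1r.
have alpha_le i : alpha * c i <= 1.
  rewrite -ler_pdivlMr // alphaE.
  exact: (bigmin_le _ i (fun i => 1 / c i)).
have p_le1 i : p i <= 1.
  have mi : measurable [set t | i \in L t].
    by apply: L_rv; exists [set S : {set 'I_d.+1} | i \in S].
  by rewrite -lee_fin fineK ?fin_num_measure // probability_le1.
(* From [alpha * sigma / p i <= alpha * c i <= 1] and [p i <= 1]. *)
have as1 : alpha * sigma <= 1.
  apply: le_trans (p_le1 ord0); rewrite -[leRHS]mul1r -ler_pdivrMr ?p_gt0 // -mulrA.
  apply: le_trans (alpha_le ord0); rewrite ler_pM2l // lerDr.
  by rewrite !mulr_ge0 ?invr_ge0 // ltW.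
have as0 : 0 <= alpha * sigma by rewrite mulr_ge0 // ltW.
case: random => coin_rv Ls_rv indep.
pose rho S := fine (P (L @^-1` [set S])).
(* [lyapunov] squares [b], hence the root of the weight. *)
pose b : 'rV[R]_d.+1 := \row_i Num.sqrt (2 * p i)^-1.
have b2 i : b 0 i ^+ 2 = (2 * p i)^-1.
  by rewrite mxE sqr_sqrtr // invr_ge0 mulr_ge0 // ltW.
exists b; split=> [i|eps k e0 e1 Qk].
  by rewrite mxE sqrtr_gt0 invr_gt0 mulr_gt0.
have ly0 xh : 0 <= lyapunov f alpha m b xstar xh.
  rewrite addr_ge0 ?sqnorm_ge0 //; apply: mulr_ge0; first by rewrite divr_ge0 ?ltW.
  by rewrite sumr_ge0 // => i _; rewrite mulr_ge0 ?sqr_ge0.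
have rate := geometric_rate (introT andP (conj as0 as1)) aQ e0 e1 Qk.
apply: (@le_trans _ _ ((1 - alpha * sigma) ^+ k *
    lyapunov f alpha m b xstar (x0, h0))%:E); last first.
  by rewrite lee_fin ler_wpM2r.
have Y_rv l : discrete_rv (coin l) by case: (coin_rv l).
have Z_rv l : discrete_rv (Ls l) by case: (Ls_rv l).
apply: (expectation_state_contraction (P := P)
  (step := svrcd_inv_step f psi alpha delta)
  (state := svrcd_inv f psi alpha delta coin Ls x0 h0) (s0 := (x0, h0))
  (fun=> erefl) (fun _ _ => erefl) Y_rv Z_rv indep (kappa := 1 - alpha * sigma)
  (py := fun c => if c then delta else 1 - delta) (pz := rho)
  (G := lyapunov f alpha m b xstar) k) => //.
- move=> l v; have [crv ctrue] := coin_rv l.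
  have -> : coin l @^-1` [set v] =
      if v then [set t | coin l t] else ~` [set t | coin l t].
    by case: v; apply/seteqP; split=> t; rewrite /preimage /=; case: (coin l t).
  have mtrue : measurable [set t | coin l t] by apply: crv; exists [set c : bool | c].
  by case: v; rewrite ?probability_setC // ctrue.
- move=> l S; have [_ ->] := Ls_rv l.
  rewrite /rho fineK // fin_num_measure //; apply: L_rv; by exists [set S].
- by rewrite subr_ge0.
- apply: (expected_lyapunov_step (p := p)) => //.
  + rewrite (sum_discrete_law P predT L_rv).
    rewrite (_ : [set t | _] = setT); last by apply/seteqP; split.
    by rewrite probability_setT.
  + by move=> i; rewrite sum_discrete_law.
  + by move=> x; exact: grad_monotone_at.
  + by move=> x; exact: (prox_nonexpansive_at psi_proper psi_convex _ psi_closed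
      a0 psix minorant).
Qed.
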